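(* Let $n=2m$ with $m\ge1$ and let $\mathcal P(2,n)=\{e_i+e_j:1\le i\le j\le n\}\subset\mathbb R^n$, with $e_i+e_j$ identified with the variable $x_{ij}$. Let $\succ$ be a total order of these points in which the anti-diagonal points satisfy $x_{m,m+1}\succ\cdots\succ x_{2,n-1}\succ x_{1n}$ and are smaller than all other points, and the other points are ordered so that $x_{ij}\succ x_{hk}$ whenever $|i-j|<|h-k|$. Then the core of the reverse lexicographic triangulation $\Delta_\succ$ of $\mathcal P(2,n)$ with respect to $\succ$ is an $(m-1)$-dimensional sphere.
   Context: Reverse lexicographic triangulation of $\mathcal A=\{a_1\succ\cdots\succ a_N\}$: if $F_1,\dots,F_k$ are the facets of $\operatorname{conv}(\mathcal A)$ not containing $a_N$, the maximal simplices of $\Delta_\succ(\mathcal A)$ are the sets $G\cup\{a_N\}$ with $G$ a maximal simplex of $\Delta_\succ(\mathcal A\cap F_i)$ (recursively, with the induced order). A cone point is a vertex lying in every facet; the core is the restriction of the complex to the non-cone-point vertices. Spheres are understood up to homeomorphism of the geometric realization. *)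

(* Defs.v *)
From HB Require Import structures.
From mathcomp Require Import all_boot all_order all_algebra.
From mathcomp Require Import all_classical all_reals all_analysis.
Set Implicit Arguments. Unset Strict Implicit. Unset Printing Implicit Defensive.
Import Order.TTheory GRing.Theory Num.Theory.
Import numFieldTopology.Exports numFieldNormedType.Exports.
Local Open Scope ring_scope.

Section Config.
Variables (R : realType) (d : nat) (I : finType).
Variable p : I -> 'rV[R]_d.

Definition dotv (u v : 'rV[R]_d) : R := \sum_(l < d) u 0 l * v 0 l.

(** F is (the set of points of S lying on) a face of conv(p S):
    cut out by a supporting hyperplane {x | <c,x> = b} with <c,.> >= b on S. *)
Definition is_face (S F : {set I}) : Prop :=
  exists (c : 'rV[R]_d) (b : R),
    (forall i, i \in S -> b <= dotv c (p i)) /\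
    F = [set i in S | dotv c (p i) == b].

Definition is_facet (S F : {set I}) : Prop :=
  [/\ is_face S F, F != S &
      forall F', is_face S F' -> F' != S -> F \subset F' -> F' = F].

(** rank : higher rank = larger in the total order; a ≻ b iff rank a > rank b *)
Variable rank : I -> nat.

Definition is_last (S : {set I}) (a : I) : Prop :=
  a \in S /\ forall b, b \in S -> (rank a <= rank b)%N.

(** revlex S s : s is a maximal simplex of the reverse lexicographic
    triangulation of p restricted to S (with the induced order). *)
Inductive revlex : {set I} -> {set I} -> Prop :=
| revlex_point : forall a : I, revlex [set a] [set a]
| revlex_step : forall (S : {set I}) (a : I) (F G : {set I}),
    (1 < #|S|)%N -> is_last S a -> is_facet S F -> a \notin F ->
    revlex F G -> revlex S (a |: G).

Definition cone_point (v : I) : Prop :=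
  forall s, revlex [set: I] s -> v \in s.

Definition revlex_core (s : {set I}) : Prop :=
  exists t, [/\ revlex [set: I] t, s \subset t &
                forall v, v \in s -> ~ cone_point v].
End Config.

Definition realization (R : realType) (I : finType) (K : {set I} -> Prop)
  : set 'rV[R]_#|I| :=
  [set x | (forall j, 0 <= x 0 j) /\ \sum_j x 0 j = 1 /\
           K [set i | x 0 (enum_rank i) != 0]].

Definition unit_sphere (R : realType) (k : nat) : set 'rV[R]_k :=
  [set y | \sum_j y 0 j ^+ 2 = 1].

Definition homeomorphic (R : realType) (a b : nat)
  (A : set 'rV[R]_a) (B : set 'rV[R]_b) : Prop :=
  exists (f : 'rV[R]_a -> 'rV[R]_b) (g : 'rV[R]_b -> 'rV[R]_a),
    {within A, continuous f}%classic /\ {within B, continuous g}%classic /\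
    (forall x, A x -> B (f x)) /\ (forall y, B y -> A (g y)) /\
    (forall x, A x -> g (f x) = x) /\ (forall y, B y -> f (g y) = y).

Definition idx (n : nat) := {k : 'I_n * 'I_n | (k.1 <= k.2)%N}.

Definition P2pt (R : realType) (n : nat) (k : idx n) : 'rV[R]_n :=
  \row_l (((l == (val k).1) : nat) + ((l == (val k).2) : nat))%:R.

(** anti-diagonal point x_{i, n+1-i} (1-indexed), i.e. i + j = n - 1 (0-indexed) *)
Definition antidiag (n : nat) (k : idx n) : bool :=
  ((val k).1 + (val k).2 == n.-1)%N.

Definition gap (n : nat) (k : idx n) : nat := ((val k).2 - (val k).1)%N.

(* Main.v *)
Require Import Defs.
From HB Require Import structures.
From mathcomp Require Import all_boot all_order all_algebra.
From mathcomp Require Import all_classical all_reals all_analysis.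
From mathcomp Require Import zify ring lra.
From mathcomp Require Import fintype finset.

(** The faces of P(2, W) are the P(2, Z) with Z a subset of W, so a maximal simplex
    is built by repeatedly deleting from W one endpoint of the smallest point x_ij.
    As long as W contains an antipodal pair {i, n+1-i}, the smallest point is
    anti-diagonal; hence the anti-diagonal points are the cone points, and afterwards
    W contains no antipodal pair and the smallest point is given by the extreme elements of W.
    A set of points is therefore a face of the core iff its points, seen as
    intervals [i, j], are pairwise nested and have no two antipodal endpoints.

    Sending x_ij to (v_i + v_j) / 2, where v_i is the i-th basis vector and v_{n+1-i}
    its opposite, maps the core onto the boundary of the m-dimensional cross-polytope,
    which is radially homeomorphic to the sphere. The inverse is explicit: a point of
    the boundary is a probability distribution u on {1, ..., n} charging no antipodal
    pair, and barycentric coordinates with nested support are the same as a symmetric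
    coupling of u with itself whose support is decreasing. There is exactly one such
    coupling, with distribution function max(U_a + U_b - 1, 0), so it depends
    continuously on u. *)

Set Implicit Arguments. Unset Strict Implicit. Unset Printing Implicit Defensive.
Import Order.TTheory GRing.Theory Num.Theory.
Import numFieldTopology.Exports numFieldNormedType.Exports.
Local Open Scope ring_scope.

(** * Faces and facets of the second dilate of a simplex *)

Section PointConfiguration.
Variables (R : realType) (n : nat).
Implicit Types (W Z : {set 'I_n}) (F : {set idx n}) (a b : idx n).

Lemma addn_rev_ord (i : 'I_n) : (i + rev_ord i = n.-1)%N.
Proof. by move: (ltn_ord i) => /=; lia. Qed.

Definition pts W : {set idx n} := [set k | ((val k).1 \in W) && ((val k).2 \in W)].

Definition dpt (i : 'I_n) : idx n := exist _ (i, i) (leqnn i).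

(** The sorted pair satisfies the subtype condition in both cases, so the default [dpt i] of
    [insubd] is never returned. *)
Definition pairing (i j : 'I_n) : idx n :=
  insubd (dpt i) (if (i <= j)%N then (i, j) else (j, i)).

Lemma val_pairing i j : val (pairing i j) = if (i <= j)%N then (i, j) else (j, i).
Proof.
rewrite val_insubd; case: (leqP i j) => /= [->//|ji].
by rewrite (ltnW ji).
Qed.

Lemma pairingC i j : pairing i j = pairing j i.
Proof.
by apply: val_inj; rewrite !val_pairing; case: ltngtP => // /val_inj ->.
Qed.

Lemma pairing_val (k : idx n) : pairing (val k).1 (val k).2 = k.
Proof.
by apply: val_inj; rewrite val_pairing; case: k => -[i j] /= ->.
Qed.

Lemma mem_pts_pairing W i j : (pairing i j \in pts W) = (i \in W) && (j \in W).
Proof. by rewrite inE val_pairing; case: ifP => _ //=; rewrite andbC. Qed.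

Lemma mem_pts_dpt W i : (dpt i \in pts W) = (i \in W).
Proof. by rewrite inE /= andbb. Qed.

Lemma pts_inj : injective pts.
Proof. by move=> W Z /setP eqWZ; apply/setP => i; rewrite -!mem_pts_dpt eqWZ. Qed.

Lemma ptsS W Z : W \subset Z -> pts W \subset pts Z.
Proof. by move=> /subsetP WZ; apply/subsetP => k; rewrite !inE => /andP[/WZ -> /WZ ->]. Qed.

Lemma dotv_P2pt (c : 'rV[R]_n) (k : idx n) :
  dotv c (P2pt R k) = c 0 (val k).1 + c 0 (val k).2.
Proof.
rewrite /dotv; under eq_bigr => l _ do rewrite mxE natrD mulrDr.
have coordE (i : 'I_n) : \sum_(l < n) c 0 l * (l == i)%:R = c 0 i.
  by rewrite (bigD1 i) //= eqxx mulr1 big1 ?addr0 // => l /negPf ->; rewrite mulr0.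
by rewrite big_split /= !coordE.
Qed.

(** A functional takes at e_i + e_j the mean of its values at 2 e_i and 2 e_j, so a supporting
    hyperplane contains x_ij exactly when it contains both diagonal points. Conversely, the
    indicator of the complement of [Z] cuts out [pts Z]. *)
Lemma face_ptsP W F :
  is_face (@P2pt R n) (pts W) F <-> exists2 Z : {set 'I_n}, Z \subset W & F = pts Z.
Proof.
split=> [[c [b [le_b ->]]]|[Z ZW ->]].
  have c2 i : i \in W -> b <= c 0 i + c 0 i.
    by rewrite -mem_pts_dpt => /le_b; rewrite dotv_P2pt.
  exists [set i in W | c 0 i + c 0 i == b].
    by apply/subsetP => i; rewrite inE => /andP[].
  apply/setP => k; rewrite !inE dotv_P2pt.
  case W1: (_ \in W) => //=; case W2: (_ \in W) => //=; last by rewrite andbF.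
  by have := c2 _ W1; have := c2 _ W2; move=> h1 h2; apply/idP/idP; lra.
exists (\row_i (i \notin Z)%:R), 0; split=> [k _|].
  by rewrite dotv_P2pt !mxE -natrD ler0n.
apply/setP => k; rewrite !inE dotv_P2pt !mxE -natrD pnatr_eq0 addn_eq0 !eqb0 !negbK.
case Z1: (_ \in Z) => //=; last by rewrite andbF.
case Z2: (_ \in Z) => //=; last by rewrite andbF.
by rewrite !(subsetP ZW).
Qed.

Lemma facet_pts W k : k \in W -> is_facet (@P2pt R n) (pts W) (pts (W :\ k)).
Proof.
move=> kW; split.
- by apply/face_ptsP; exists (W :\ k) => //; apply: subD1set.
- by apply/eqP => /pts_inj /setP /(_ k); rewrite setD11 kW.
move=> _ /face_ptsP[Z ZW ->] ZneqW sWZ; congr pts; apply/eqP.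
have {}sWZ : W :\ k \subset Z.
  by apply/subsetP => i iW; rewrite -mem_pts_dpt (subsetP sWZ) // mem_pts_dpt.
rewrite eqEsubset sWZ andbT subsetD1 ZW /=; apply: contra ZneqW => kZ.
by rewrite (_ : Z = W) //; apply/eqP; rewrite eqEsubset ZW -(setD1K kW) subUset sub1set kZ.
Qed.

(** A facet [pts Z] avoiding [a] has an endpoint [k] of [a] outside [Z], hence lies in
    [pts (W :\ k)]; maximality makes them equal. *)
Lemma facet_ptsE W F a : is_facet (@P2pt R n) (pts W) F -> a \in pts W ->
  a \notin F ->
  exists2 k, (k == (val a).1) || (k == (val a).2) & F = pts (W :\ k).
Proof.
move=> [/face_ptsP[Z ZW ->] _ Fmax] aW aZ.
have ZE k : k \in W -> k \notin Z -> pts Z = pts (W :\ k).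
  move=> kW kZ; have [fW nW _] := facet_pts kW.
  by rewrite [RHS]Fmax // ptsS // subsetD1 ZW.
move: aW aZ; rewrite !inE negb_and => /andP[a1 a2] /orP[aZ|aZ].
  by exists (val a).1; [rewrite eqxx|apply: ZE].
by exists (val a).2; [rewrite eqxx orbT|apply: ZE].
Qed.

Lemma card_pts_gt1 W : (1 < #|pts W|)%N = (1 < #|W|)%N.
Proof.
apply/idP/idP => [/card_gt1P[a [b [aW bW]]]|/card_gt1P[i [j [iW jW ij]]]]; last first.
  apply/card_gt1P; exists (dpt i), (dpt j); rewrite !mem_pts_dpt; split=> //.
  by apply: contra ij => /eqP[->].
apply: contraR; rewrite -leqNgt => /card_le1_eqP W1; apply/eqP.
move: aW bW; rewrite !inE => /andP[a1 a2] /andP[b1 b2].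
apply: val_inj; case: (val a) (val b) a1 a2 b1 b2 => [i j] [k l] /= iW jW kW lW.
by rewrite (W1 i k) // (W1 j l).
Qed.

Lemma pts_eq1 W a : pts W = [set a] -> W = [set (val a).1].
Proof.
move=> Wa; apply/setP => i; rewrite inE -mem_pts_dpt Wa inE; apply/eqP/eqP => [<-//|->].
have : a \in pts W by rewrite Wa set11.
by rewrite inE => /andP[]; rewrite -mem_pts_dpt Wa inE => /eqP.
Qed.

End PointConfiguration.

(** * Maximal simplices and the core, in terms of nested intervals *)

Section Core.
Variables (R : realType) (n : nat) (rank : idx n -> nat).
Hypothesis n_even : ~~ odd n.
Hypothesis rank_antidiag : forall a b : idx n, antidiag a -> ~~ antidiag b ->
  (rank a < rank b)%N.
Hypothesis rank_gap : forall a b : idx n, ~~ antidiag a -> ~~ antidiag b ->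
  (gap a < gap b)%N -> (rank b < rank a)%N.
Implicit Types (W Z : {set 'I_n}) (s t : {set idx n}) (a b p q : idx n).

Definition nested p q : bool :=
  ((val p).1 <= (val q).1)%N && ((val q).2 <= (val p).2)%N
  || ((val q).1 <= (val p).1)%N && ((val p).2 <= (val q).2)%N.

Definition ends p : seq 'I_n := [:: (val p).1; (val p).2].

Definition antipodal p q : bool :=
  [exists i, exists j, [&& i \in ends p, j \in ends q & (i + j == n.-1)%N]].

(** The case [p = q] is meaningful: for even [n] it excludes exactly the anti-diagonal points. *)
Definition compat p q : bool := nested p q && ~~ antipodal p q.

Lemma antipodalP p q : reflect
  (exists i j : 'I_n, [/\ i \in ends p, j \in ends q & (i + j = n.-1)%N])
  (antipodal p q).
Proof.
apply: (iffP existsP) => [[i /existsP[j /and3P[? ? /eqP ?]]]|[i [j [? ? /eqP ?]]]].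
  by exists i, j.
by exists i; apply/existsP; exists j; apply/and3P.
Qed.

Lemma mem_ends_pairing i j k : (k \in ends (pairing i j)) = (k == i) || (k == j).
Proof.
by rewrite /ends val_pairing; case: ifP => _ /=; rewrite !inE //; rewrite orbC.
Qed.

Lemma mem_ptsE W p : p \in pts W = all (mem W) (ends p).
Proof. by rewrite inE /= andbT. Qed.

Lemma mem_pts_ends W p i : p \in pts W -> i \in ends p -> i \in W.
Proof. by rewrite mem_ptsE => /allP; apply. Qed.

Lemma compatC p q : compat p q = compat q p.
Proof.
rewrite /compat /nested orbC; congr (_ && ~~ _).
by apply/antipodalP/antipodalP => -[i [j [? ? ?]]]; exists j, i; rewrite addnC.
Qed.

Lemma antidiag_dpt (i : 'I_n) : ~~ antidiag (dpt i).
Proof. by rewrite /antidiag /=; apply/eqP; have := ltn_ord i; lia. Qed.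

Lemma exists_last W : W != set0 -> exists a, is_last rank (pts W) a.
Proof.
move=> /set0Pn[i]; rewrite -mem_pts_dpt => iW.
case: (arg_minnP rank iW) => a aW amin.
by exists a.
Qed.

(** An antipodal pair in [W] would give an anti-diagonal point of [pts W], smaller than [a]. *)
Lemma is_last_antipode W a : is_last rank (pts W) a -> ~~ antidiag a ->
  forall i j, i \in W -> j \in W -> (i + j != n.-1)%N.
Proof.
move=> [aW amin] nda i j iW jW; apply/negP => ij.
have /amin : pairing i j \in pts W by rewrite mem_pts_pairing iW.
rewrite leqNgt rank_antidiag // /antidiag val_pairing.
by case: ifP => //=; rewrite addnC.
Qed.

(** Without antipodal pairs in [W] the smallest point is one of largest gap, so its endpoints are
    the minimum and maximum of [W]. *)
Lemma is_last_bounds W a : is_last rank (pts W) a -> ~~ antidiag a ->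
  forall i, i \in W -> ((val a).1 <= i <= (val a).2)%N.
Proof.
move=> la nda i iW; have noanti := is_last_antipode la nda.
case: la => aW amin.
have /andP[a1 a2] : ((val a).1 \in W) && ((val a).2 \in W) by move: aW; rewrite inE.
have gap_le j k : j \in W -> k \in W -> (k - j <= (val a).2 - (val a).1)%N.
  move=> jW kW; rewrite leqNgt; apply/negP => lt.
  have /amin : pairing j k \in pts W by rewrite mem_pts_pairing jW.
  rewrite leqNgt rank_gap //.
    by rewrite /antidiag val_pairing; case: ifP => _; apply: noanti.
  by rewrite /gap val_pairing; case: ifP => //=; lia.
have := gap_le _ _ iW a2; have := gap_le _ _ a1 iW; have := valP a.
by move=> /=; lia.
Qed.

(** Every configuration met in the recursion is some [pts W], so the induction can run on [W]. *)
Lemma revlex_ind_pts (Q : {set 'I_n} -> {set idx n} -> Prop) :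
  (forall i, Q [set i] [set dpt i]) ->
  (forall W a k t, is_last rank (pts W) a -> k \in ends a ->
     revlex (@P2pt R n) rank (pts (W :\ k)) t ->
     Q (W :\ k) t -> Q W (a |: t)) ->
  forall W t, revlex (@P2pt R n) rank (pts W) t -> Q W t.
Proof.
move=> Q1 QS W t; move: {-1}(pts W) (erefl (pts W)) => S SE rev.
elim: rev W SE => {S t} [a W Wa|S a F G _ la fF aF rG IH W SE].
  have WE := pts_eq1 Wa; have := Q1 (val a).1.
  have : dpt (val a).1 \in pts W by rewrite mem_pts_dpt WE set11.
  by rewrite Wa inE => /eqP ->; rewrite -WE.
rewrite -{}SE in la fF; have [k ka FE] := facet_ptsE fF la.1 aF.
by subst F; apply: (QS W a k G) => //; [rewrite !inE|exact: IH].
Qed.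

Lemma revlex_step_pts W a k t : (1 < #|W|)%N -> is_last rank (pts W) a ->
  k \in ends a -> revlex (@P2pt R n) rank (pts (W :\ k)) t ->
  revlex (@P2pt R n) rank (pts W) (a |: t).
Proof.
move=> W1 la ka; apply: revlex_step => //; first by rewrite card_pts_gt1.
  exact/facet_pts/(mem_pts_ends la.1).
by apply/negP => /mem_pts_ends /(_ ka); rewrite setD11.
Qed.

Lemma revlex_sub W t : revlex (@P2pt R n) rank (pts W) t -> t \subset pts W.
Proof.
move: W t; apply: revlex_ind_pts => [i|W a k t [aW _] _ _ IH].
  by rewrite sub1set mem_pts_dpt set11.
by rewrite subUset sub1set aW (subset_trans IH) // ptsS // subD1set.
Qed.

(** If the last point [a] is not anti-diagonal, [W] has no antipodal pair and [a] spans [W]; hence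
    [a] is compatible with every point of [pts W], in particular with those chosen later. *)
Lemma revlex_compat W t : revlex (@P2pt R n) rank (pts W) t ->
  {in t &, forall p q, ~~ antidiag p -> ~~ antidiag q -> compat p q}.
Proof.
move: W t; apply: revlex_ind_pts => [i p q|W a k t la ka rt IH].
  rewrite !inE => /eqP -> /eqP -> _ _; rewrite /compat /nested leqnn /=.
  apply/antipodalP => -[? [? []]]; rewrite !inE !orbb => /eqP -> /eqP -> ii.
  by have := ltn_ord i; lia.
have tW p : p \in a |: t -> p \in pts W.
  rewrite in_setU1 => /orP[/eqP ->|]; first exact: la.1.
  by move/(subsetP (revlex_sub rt)); apply/subsetP/ptsS/subD1set.
have compat_last p : p \in a |: t -> ~~ antidiag a -> compat a p.
  move=> /tW pW nda; apply/andP; split.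
    have pB := is_last_bounds la nda; move: pW; rewrite inE => /andP[/pB p1 /pB p2].
    by rewrite /nested; case/andP: p1 => -> _; case/andP: p2 => _ ->.
  apply/antipodalP => -[i [j [ia jp /eqP]]]; apply/negP.
  by apply: (is_last_antipode la nda);
    [exact: mem_pts_ends la.1 ia|exact: mem_pts_ends jp].
move=> p q pt qt ndp ndq.
case: (eqVneq p a) => [pa|pa]; first by subst p; apply: compat_last.
case: (eqVneq q a) => [qa|qa]; first by subst q; rewrite compatC; apply: compat_last.
move: pt qt; rewrite !inE (negPf pa) (negPf qa) /= => pt qt.
exact: (IH p q).
Qed.

(** Distinct anti-diagonal points share no endpoint, so deleting an endpoint of one keeps all the
    others available until they are last themselves. *)
Lemma antidiag_revlex W t a : revlex (@P2pt R n) rank (pts W) t ->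
  antidiag a -> a \in pts W -> a \in t.
Proof.
move=> rt da; move: W t rt; apply: revlex_ind_pts => [i|W b k t lb kb rt IH aW].
  rewrite inE !inE => /andP[/eqP a1 /eqP a2]; case/negP: (antidiag_dpt i).
  by move: da; rewrite /antidiag a1 a2.
case: (eqVneq a b) => [->|ab]; first exact: setU11.
rewrite inE IH ?orbT // {IH}.
have db : antidiag b by apply: contraT => ndb; have := lb.2 _ aW; rewrite leqNgt rank_antidiag.
suff kNa : k \notin ends a.
  by move: aW kNa; rewrite !inE negb_or ![k == _]eq_sym => /andP[-> ->] /andP[-> ->].
apply: contra ab => ka; apply/eqP/val_inj.
have := valP a; have := valP b; move: da db ka kb; rewrite /antidiag !inE.
case: (val a) (val b) => [i j] [i' j'] /= /eqP eij /eqP eij' ka kb ij' ij.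
have [] : i = i' :> nat /\ j = j' :> nat.
  by case/orP: ka => /eqP ka; case/orP: kb => /eqP kb; subst k;
    move: eij eij' ij ij'; rewrite -?kb; lia.
by move=> /val_inj -> /val_inj ->.
Qed.

(** A maximal simplex is grown around [s] by always deleting an endpoint of the last point that no
    other point of [s] uses. *)
Lemma revlex_extend W s : W != set0 -> s \subset pts W ->
  {in s &, forall p q, compat p q} ->
  exists2 t, revlex (@P2pt R n) rank (pts W) t & s \subset t.
Proof.
move: {2}#|W| (leqnn #|W|) => N; elim: N W s => [|N IH] W s.
  by rewrite leqn0 cards_eq0 => ->.
move=> WN W0 sW sC; have [a la] := exists_last W0.
(* A singleton is the base case of [revlex]; deleting its element would leave nothing to
   triangulate. *)
have [W1|W1] := leqP #|W| 1.
  have /cards1P[i Wi] : #|W| == 1 by rewrite eqn_leq W1 card_gt0.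
  have ptsE : pts W = [set dpt i].
    apply/setP => p; rewrite Wi !inE; apply/andP/eqP => [[/eqP p1 /eqP p2]|->//].
    by apply: val_inj; rewrite [LHS]surjective_pairing p1 p2.
  exists [set dpt i]; last by rewrite -ptsE.
  rewrite ptsE.
  exact: revlex_point.
have [k ka ks] : exists2 k, k \in ends a & {in s, forall p, p != a -> k \notin ends p}.
  case: (boolP [forall p in s, (p != a) ==> ((val a).1 \notin ends p)]) => [/forall_inP h|].
    by exists (val a).1; rewrite ?inE ?eqxx // => p /h /implyP.
  rewrite negb_forall_in => /exists_inP[p ps]; rewrite negb_imply negbK => /andP[pa a1p].
  exists (val a).2; rewrite ?inE ?eqxx ?orbT // => q qs qa; apply/negP => a2q.
  have /andP[npq /antipodalP[]] := sC _ _ ps qs.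
  (* Suppose [p] and [q], both different from [a], use its first and second endpoint. For
     anti-diagonal [a] they are antipodal. Otherwise [a] spans [W], so [p] stops short of the right
     end and [q] of the left end, and they are not nested. *)
  exists (val a).1, (val a).2; split=> //; apply/eqP; apply: contraT => nda.
  have aB := is_last_bounds la nda.
  have := mem_pts_ends (subsetP sW _ ps); have := mem_pts_ends (subsetP sW _ qs).
  move=> /(_ _ _) qW /(_ _ _) pW.
  have {qW} qB i iq := aB i (qW i iq); have {pW} pB i ip := aB i (pW i ip).
  have p1 := pB (val p).1; have p2 := pB (val p).2.
  have q1 := qB (val q).1; have q2 := qB (val q).2.
  move: p1 p2 q1 q2; rewrite !inE !eqxx ?orbT.
  move=> /(_ isT) p1 /(_ isT) p2 /(_ isT) q1 /(_ isT) q2.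
  have pneq : ((val p).1 != (val a).1 :> nat) || ((val p).2 != (val a).2 :> nat).
    apply: contraR pa; rewrite negb_or !negbK => /andP[/eqP/val_inj e1 /eqP/val_inj e2].
    by apply/eqP/val_inj; case: (val p) (val a) e1 e2 => ? ? [? ?] /= -> ->.
  have qneq : ((val q).1 != (val a).1 :> nat) || ((val q).2 != (val a).2 :> nat).
    apply: contraR qa; rewrite negb_or !negbK => /andP[/eqP/val_inj e1 /eqP/val_inj e2].
    by apply/eqP/val_inj; case: (val q) (val a) e1 e2 => ? ? [? ?] /= -> ->.
  have vp := valP p; have vq := valP q; have va := valP a.
  move: npq a1p a2q vp vq va p1 p2 q1 q2 pneq qneq; rewrite /nested !inE -!val_eqE /=.
  clear; lia.
have kW := mem_pts_ends la.1 ka.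
have [||||t rt st] := IH (W :\ k) (s :\ a).
- by rewrite -ltnS; apply: leq_trans WN; rewrite (cardsD1 k W) kW.
- by rewrite -card_gt0; move: W1; rewrite (cardsD1 k W) kW.
- apply/subsetP => p; rewrite in_setD1 => /andP[pa ps].
  have := subsetP sW _ ps; have := ks _ ps pa.
  by rewrite !inE negb_or ![k == _]eq_sym => /andP[-> ->] /andP[-> ->].
- by move=> p q; rewrite !in_setD1 => /andP[_ ps] /andP[_ qs]; apply: sC.
exists (a |: t); first exact: revlex_step_pts rt.
apply/subsetP => p ps; rewrite in_setU1; case: eqVneq => //= pa.
by apply: (subsetP st); rewrite in_setD1 pa.
Qed.

Lemma cone_pointE a : cone_point (@P2pt R n) rank a <-> antidiag a.
Proof.
have setTE : [set: idx n] = pts [set: 'I_n] by apply/setP => p; rewrite !inE.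
rewrite /cone_point setTE; split=> [ca|da t rt]; last first.
  by apply: antidiag_revlex rt _ _ => //; rewrite !inE.
(* The diagonal point at the antipode of an endpoint of [a] lies in some maximal simplex, and it is
   incompatible with [a]. *)
apply: contraT => nda; pose i := rev_ord (val a).1.
have [||p q|t rt] := @revlex_extend setT [set dpt i].
- by apply/set0Pn; exists i.
- by rewrite -setTE subsetT.
- rewrite !inE => /eqP -> /eqP ->; rewrite /compat /nested leqnn /=.
  apply/antipodalP => -[? [? []]]; rewrite !inE !orbb => /eqP -> /eqP -> ii.
  by have := ltn_ord (rev_ord (val a).1); lia.
rewrite sub1set => it.
have /andP[_ /antipodalP[]] := revlex_compat rt (ca _ rt) it nda (antidiag_dpt i).
exists (val a).1, i; rewrite !inE !eqxx; split=> //.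
exact: addn_rev_ord.
Qed.

Lemma revlex_coreE s : (0 < n)%N ->
  revlex_core (@P2pt R n) rank s <-> {in s &, forall p q, compat p q}.
Proof.
move=> n_gt0; have setTE : [set: idx n] = pts [set: 'I_n] by apply/setP => p; rewrite !inE.
split=> [[t []]|sC].
  rewrite setTE => rt st sN p q ps qs.
  by apply: revlex_compat rt _ _ _ _ _ _; rewrite ?(subsetP st) //;
    apply/negP => /cone_pointE; apply: sN.
have [||t rt st] := @revlex_extend setT s _ _ sC.
- by apply/set0Pn; exists (Ordinal n_gt0).
- by rewrite -setTE subsetT.
(* A cone point in [s] would be antipodal to itself, against [sC] with both arguments equal to
   [p]. *)
exists t; rewrite setTE; split=> // p ps /cone_pointE dp.
have /andP[_ /antipodalP[]] := sC _ _ ps ps.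
by exists (val p).1, (val p).2; rewrite !inE !eqxx orbT; split=> //; apply/eqP.
Qed.

End Core.

(** * Countermonotone couplings and symmetric matrices *)

Section CountermonotoneCoupling.
Variables (R : realType) (n : nat).
Implicit Types (u : 'I_n -> R) (M : 'I_n -> 'I_n -> R) (t : R).

Definition pospart t : R := Num.max t 0.

Lemma pospart_ge0 t : 0 <= pospart t.
Proof. by rewrite le_max lexx orbT. Qed.

Lemma pospart_id t : 0 <= t -> pospart t = t.
Proof. exact: max_l. Qed.

Lemma pospart_eq0 t : t <= 0 -> pospart t = 0.
Proof. exact: max_r. Qed.

Lemma pospartB t : pospart t - pospart (- t) = t.
Proof.
by case: (leP 0 t) => t0;
  [rewrite pospart_id // pospart_eq0|rewrite pospart_eq0 ?pospart_id]; lra.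
Qed.

Lemma pospartZ c t : 0 <= c -> pospart (c * t) = c * pospart t.
Proof. by move=> c0; rewrite /pospart maxr_pMr // mulr0. Qed.

(** The strict bound makes [cum u i] and [cum u i.+1] the distribution function just before and at
    [i]. *)
Definition cum u (a : nat) : R := \sum_(i < n | (i < a)%N) u i.

Lemma cum0 u : cum u 0 = 0.
Proof. exact: big_pred0. Qed.

Lemma cum_full u : cum u n = \sum_i u i.
Proof. by apply: eq_bigl => i; rewrite ltn_ord. Qed.

Lemma cumS u (i : 'I_n) : cum u i.+1 = cum u i + u i.
Proof.
rewrite /cum (bigD1 i) //= addrC; congr (_ + _); apply: eq_bigl => j.
by rewrite ltnS ltn_neqAle andbC.
Qed.

Lemma le_cum u a b : (forall i, 0 <= u i) -> (a <= b)%N -> cum u a <= cum u b.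
Proof.
move=> u0 ab; rewrite /cum [leRHS](bigID (fun i : 'I_n => (i < a)%N)) /=.
rewrite [leLHS](eq_bigl (fun i : 'I_n => (i < b)%N && (i < a)%N)) ?lerDl ?sumr_ge0 //.
by move=> i; case: (ltnP i a) => ia; rewrite ?andbF // (leq_trans ia).
Qed.

(* The joint distribution function of two countermonotone variables distributed
   like u is max(U_a + U_b - 1, 0); this is the mass it puts on (i, j). *)
Definition countermono u (i j : 'I_n) : R :=
  pospart (cum u i.+1 + cum u j.+1 - 1) - pospart (cum u i + cum u j.+1 - 1)
  - pospart (cum u i.+1 + cum u j - 1) + pospart (cum u i + cum u j - 1).

Lemma countermonoC u i j : countermono u i j = countermono u j i.
Proof.
rewrite /countermono (addrC (cum u i.+1)) (addrC (cum u i)).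
by rewrite (addrC (cum u i.+1)) (addrC (cum u i)); ring.
Qed.

(** This is the mixed difference of max(x + y - 1, 0) over the rectangle [a, b] x [c, d]:
    nonnegative by convexity, and nonzero only if the line x + y = 1 crosses the interior. *)
Lemma pospart2_diff (a b c d : R) : a <= b -> c <= d ->
  let h := pospart (b + d - 1) - pospart (a + d - 1) - pospart (b + c - 1)
           + pospart (a + c - 1) in
  0 <= h /\ (h != 0 -> [/\ 1 < b + d, a + c < 1, a < b & c < d]).
Proof.
move=> ab cd h.
suff [h0 hP] : 0 <= h /\ (0 < h -> [/\ 1 < b + d, a + c < 1, a < b & c < d]).
  by split=> // hn0; apply: hP; rewrite lt_def hn0.
have pospartP t : (t <= 0 /\ pospart t = 0) \/ (0 <= t /\ pospart t = t).
  by case: (leP t 0) => t0; [left; rewrite pospart_eq0|right; rewrite pospart_id ltW].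
rewrite /h {h}.
case: (pospartP (b + d - 1)) => -[? ->]; case: (pospartP (a + d - 1)) => -[? ->];
case: (pospartP (b + c - 1)) => -[? ->]; case: (pospartP (a + c - 1)) => -[? ->];
(split; [lra|move=> ?; split; lra]).
Qed.

Section Distribution.
Variable u : 'I_n -> R.
Hypotheses (u_ge0 : forall i, 0 <= u i) (u_sum : \sum_i u i = 1).

Let cum_le1 a : cum u a <= 1.
Proof.
rewrite -u_sum /cum [leRHS](bigID (fun i : 'I_n => (i < a)%N)) /= lerDl.
exact: sumr_ge0.
Qed.

Let cum_ge0 a : 0 <= cum u a.
Proof. exact: sumr_ge0. Qed.

Lemma countermono_ge0 i j : 0 <= countermono u i j.
Proof.
by apply: (proj1 (pospart2_diff _ _)); apply: le_cum.
Qed.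

Lemma countermono_neq0 i j : countermono u i j != 0 ->
  [/\ 1 < cum u i.+1 + cum u j.+1, cum u i + cum u j < 1, u i != 0 & u j != 0].
Proof.
move=> /(proj2 (pospart2_diff _ _)) -[]; [exact: le_cum|exact: le_cum|].
by rewrite !cumS !ltrDl => ? ? /gt_eqF -> /gt_eqF ->.
Qed.

(** In cumulative coordinates the cell (k, l) lies above and to the right of the cell (i, j), so the
    line x + y = 1 cannot cross the interior of both. *)
Lemma countermono_antitone (i j k l : 'I_n) : (i < k)%N -> (j < l)%N ->
  countermono u i j != 0 -> countermono u k l != 0 -> False.
Proof.
move=> ik jl /countermono_neq0[h1 _ _ _] /countermono_neq0[_ h2 _ _].
by have := le_cum u_ge0 ik; have := le_cum u_ge0 jl; lra.
Qed.

(** The sum telescopes in [j]: the terms at 0 vanish because [cum] is at most 1, and those at [n]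
    leave the increment of [cum u] at [i]. *)
Lemma sum_countermono i : \sum_j countermono u i j = u i.
Proof.
pose G b := pospart (cum u i.+1 + cum u b - 1) - pospart (cum u i + cum u b - 1).
rewrite (eq_bigr (fun j : 'I_n => G j.+1 - G j)); last first.
  by move=> j _; rewrite /G /countermono; ring.
rewrite -(big_mkord predT (fun j => G j.+1 - G j)) telescope_sumr // /G cum0 cum_full u_sum.
have := cum_le1 i; have := cum_le1 i.+1; have := cum_ge0 i; have := cum_ge0 i.+1.
rewrite cumS => ? ? ? ?.
by rewrite !(@pospart_eq0 (_ + 0 - 1)) ?pospart_id; lra.
Qed.

End Distribution.

(** For each (a, b), U_a + U_b - 1 is the mass of the lower left quadrant minus that of the upper
    right one. Antitone support empties one of the two, so the positive part is the joint
    distribution function of [M], which determines [M]. *)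
Lemma countermono_unique M :
  (forall i j, 0 <= M i j) -> (forall i j, M i j = M j i) ->
  \sum_i \sum_j M i j = 1 ->
  (forall i j k l : 'I_n, (i < k)%N -> (j < l)%N -> M i j != 0 -> M k l != 0 -> False) ->
  forall i j, countermono (fun i => \sum_j M i j) i j = M i j.
Proof.
move=> M0 MC M1 Manti; set u := fun i => _.
pose cdf a b := cum (fun i => cum (M i) b) a.
suff cdfE a b : pospart (cum u a + cum u b - 1) = cdf a b.
  move=> i j; rewrite /countermono !cdfE /cdf cumS [cum _ i.+1]cumS cumS.
  by ring.
pose D := \sum_(i < n | ~~ (i < a)%N) \sum_(j < n | ~~ (j < b)%N) M i j.
have uE i : u i = cum (M i) b + \sum_(j < n | ~~ (j < b)%N) M i j.
  by rewrite /u (bigID (fun j : 'I_n => (j < b)%N)).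
(* By symmetry of [M] its column sums are [u] as well. *)
have ubE : 1 - cum u b = \sum_i \sum_(j < n | ~~ (j < b)%N) M i j.
  rewrite -M1 (bigID (fun j : 'I_n => (j < b)%N)) /= addrC addrK exchange_big /=.
  by apply: eq_bigr => i _; apply: eq_bigr => j _.
have -> : cum u a + cum u b - 1 = cdf a b - D.
  have uaE : cum u a = cdf a b + \sum_(i < n | (i < a)%N) \sum_(j < n | ~~ (j < b)%N) M i j.
    by rewrite /cum (eq_bigr _ (fun i _ => uE i)) big_split.
  move: ubE; rewrite (bigID (fun i : 'I_n => (i < a)%N)) /= -/D uaE.
  by move=> ubE; lra.
have cdf0 : 0 <= cdf a b by apply: sumr_ge0 => i _; apply: sumr_ge0.
case: (boolP [exists k : 'I_n, exists l : 'I_n, [&& ~~ (k < a)%N, ~~ (l < b)%N & M k l != 0]]).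
  move=> /existsP[k /existsP[l /and3P[ka lb kl]]].
  have -> : cdf a b = 0.
    rewrite /cdf /cum big1 // => i ia; rewrite big1 // => j jb; apply/eqP/negPn/negP => ij.
    by apply: (Manti i j k l) => //; lia.
  rewrite pospart_eq0 // sub0r oppr_le0.
  by apply: sumr_ge0 => i _; apply: sumr_ge0.
rewrite negb_exists => /forallP h.
suff -> : D = 0 by rewrite subr0 pospart_id.
rewrite /D big1 // => k ka; rewrite big1 // => l lb; apply/eqP.
by have := h k; rewrite negb_exists => /forallP /(_ l); rewrite ka lb /= negbK.
Qed.

Implicit Types (x : idx n -> R).

(** The mass of an off-diagonal point is split evenly between (i, j) and (j, i). *)
Definition symm x i j : R := x (pairing i j) * (if i == j then 1 else 2^-1).

Definition unsymm M (k : idx n) : R :=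
  M (val k).1 (val k).2 * (if (val k).1 == (val k).2 then 1 else 2).

Lemma symmC x i j : symm x i j = symm x j i.
Proof. by rewrite /symm pairingC eq_sym. Qed.

Lemma symmK x k : unsymm (symm x) k = x k.
Proof. by rewrite /unsymm /symm pairing_val; case: ifP => _; field. Qed.

Lemma unsymmK M i j : (forall i j, M i j = M j i) -> symm (unsymm M) i j = M i j.
Proof.
move=> MC; rewrite /unsymm /symm val_pairing.
case: (eqVneq i j) => [->|ij]; first by rewrite leqnn /= eqxx; ring.
by case: ifP => _ /=; rewrite ?(negPf ij) 1?eq_sym ?(negPf ij) 1?MC; field.
Qed.

Lemma sum_symm x : \sum_i \sum_j symm x i j = \sum_k x k.
Proof.
rewrite pair_bigA /= (partition_big (fun p => pairing p.1 p.2) predT) //=.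
apply: eq_bigr => k _; rewrite (bigD1 ((val k).1, (val k).2)) /=; last by rewrite pairing_val.
have fiber (p : 'I_n * 'I_n) : pairing p.1 p.2 = k ->
    p = ((val k).1, (val k).2) \/ p = ((val k).2, (val k).1).
  move=> <-; rewrite val_pairing; case: ifP => _; [left|right];
  exact: surjective_pairing.
have kk := pairing_val k.
rewrite {1}/symm kk; case: (eqVneq (val k).1 (val k).2) => [k12|k12].
  rewrite mulr1 big1 ?addr0 // => p /andP[/eqP /fiber [->|->]];
  by rewrite k12 ?eqxx.
rewrite (big_pred1 ((val k).2, (val k).1)) /=; last first.
  move=> p; apply/andP/eqP => [[/eqP /fiber [->|->//]]|->]; first by rewrite eqxx.
  by rewrite pairingC kk; split=> //; apply: contra k12 => /eqP[->].
by rewrite /symm pairingC kk eq_sym (negPf k12); field.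
Qed.

(** When i < k and j < l, the sorted pairs have both endpoints strictly ordered the same way, so
    neither interval contains the other. *)
Lemma compat_antitone x : (forall p q, x p != 0 -> x q != 0 -> compat p q) ->
  forall i j k l : 'I_n, (i < k)%N -> (j < l)%N -> symm x i j != 0 ->
    symm x k l != 0 -> False.
Proof.
move=> xC i j k l ik jl; rewrite /symm !mulf_eq0 !negb_or => /andP[ij _] /andP[kl _].
have /andP[+ _] := xC _ _ ij kl.
by rewrite /nested !val_pairing; do 2 case: ifP => /=; lia.
Qed.

End CountermonotoneCoupling.

(** * Signed coordinates on the cross-polytope *)

Section Folding.
Variables (R : realType) (m : nat).
Local Notation n := (2 * m)%N.
Implicit Types (y z : 'rV[R]_m) (u : 'I_n -> R).

Definition lo (l : 'I_m) : 'I_n := widen_ord (leq_pmull m (ltn0Sn 1)) l.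

Lemma lo_or_rev (i : 'I_n) : exists l, i = lo l \/ i = rev_ord (lo l).
Proof.
have [im|mi] := ltnP i m; first by exists (Ordinal im); left; apply: val_inj.
have im : (n - i.+1 < m)%N by have := ltn_ord i; lia.
exists (Ordinal im); right; apply: val_inj => /=.
by have := ltn_ord i; lia.
Qed.

Lemma rev_lo (l k : 'I_m) : (rev_ord (lo l) == lo k) = false.
Proof. by apply/eqP => /(congr1 val) /=; have := ltn_ord l; have := ltn_ord k; lia. Qed.

(* [lo l] stands for the l-th basis vector and [rev_ord (lo l)] for its opposite. *)
Definition fold u : 'rV[R]_m := \row_l (u (lo l) - u (rev_ord (lo l))).

Definition signed y (i : 'I_n) : R :=
  \sum_l y 0 l * ((lo l == i)%:R - (rev_ord (lo l) == i)%:R).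

Lemma signed_lo y l : signed y (lo l) = y 0 l.
Proof.
rewrite /signed (bigD1 l) //= eqxx rev_lo subr0 mulr1 big1 ?addr0 // => k kl.
rewrite rev_lo (_ : (lo k == lo l) = false) ?subr0 ?mulr0 //.
by apply: contraNF kl => /eqP /(congr1 val) /= ?; apply/eqP/val_inj.
Qed.

Lemma signed_rev y i : signed y (rev_ord i) = - signed y i.
Proof.
rewrite /signed -sumrN; apply: eq_bigr => l _; rewrite -mulrN opprB.
by rewrite (inj_eq rev_ord_inj) -{1}[lo l]rev_ordK (inj_eq rev_ord_inj).
Qed.

Lemma signedZ c y i : signed (c *: y) i = c * signed y i.
Proof. by rewrite /signed mulr_sumr; apply: eq_bigr => l _; rewrite mxE mulrA. Qed.

Lemma signed_fold u i : signed (fold u) i = u i - u (rev_ord i).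
Proof.
have [l [->|->]] := lo_or_rev i; first by rewrite signed_lo mxE.
by rewrite signed_rev signed_lo mxE rev_ordK opprB.
Qed.

Definition unfold y (i : 'I_n) : R := pospart (signed y i).
(** This is the l1 norm, since the positive parts of y_l and -y_l add up to |y_l|. *)
Definition norm1 y : R := \sum_i unfold y i.

Lemma unfold_ge0 y i : 0 <= unfold y i.
Proof. exact: pospart_ge0. Qed.

Lemma unfold_rev y i : unfold y i != 0 -> unfold y (rev_ord i) = 0.
Proof.
rewrite /unfold signed_rev; have [y0|y0] := leP 0 (signed y i).
  by rewrite [in X in _ -> X]pospart_eq0 // oppr_le0.
by rewrite pospart_eq0 ?eqxx // ltW.
Qed.

Lemma unfoldZ c y i : 0 <= c -> unfold (c *: y) i = c * unfold y i.
Proof. by move=> c0; rewrite /unfold signedZ pospartZ. Qed.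

Lemma norm1Z c y : 0 <= c -> norm1 (c *: y) = c * norm1 y.
Proof. by move=> c0; rewrite /norm1 mulr_sumr; apply: eq_bigr => i _; rewrite unfoldZ. Qed.

Lemma unfoldK y : fold (unfold y) = y.
Proof. by apply/rowP => l; rewrite mxE /unfold signed_rev pospartB signed_lo. Qed.

Lemma foldK u : (forall i, 0 <= u i) -> (forall i, u i != 0 -> u (rev_ord i) = 0) ->
  forall i, unfold (fold u) i = u i.
Proof.
move=> u0 urev i; rewrite /unfold signed_fold; case: (eqVneq (u i) 0) => [->|/urev ->].
  by rewrite sub0r pospart_eq0 // oppr_le0.
by rewrite subr0 pospart_id.
Qed.

Lemma norm1_gt0 y : y != 0 -> 0 < norm1 y.
Proof.
move=> y0; rewrite lt_def sumr_ge0 ?andbT => [|i _]; last exact: unfold_ge0.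
apply: contra y0 => /eqP/psumr_eq0P h; apply/eqP; rewrite -[y]unfoldK; apply/rowP => l.
by rewrite !mxE !h ?subr0 // => i _; apply: unfold_ge0.
Qed.

Lemma foldZ c u : fold (fun i => c * u i) = c *: fold u.
Proof. by apply/rowP => l; rewrite !mxE mulrBr. Qed.

End Folding.

(** * Continuity of row-valued maps, cumulative sums and couplings *)

Section Continuity.
Variables (R : realType) (T : topologicalType).

Lemma continuous_row (k : nat) (f : T -> 'rV[R]_k) (x : T) :
  (forall l, {for x, continuous (fun y => f y 0 l)}) -> {for x, continuous f}.
Proof.
move=> fc A [P nP sPA].
have : \forall y \near x, forall ij : 'I_1 * 'I_k, P ij.1 ij.2 (f y ij.1 ij.2).
  apply: filter_forall => -[i l]; rewrite (ord1 i); apply: fc.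
  exact: nP.
by apply: filterS => y Py; apply: sPA => i j; exact: (Py (i, j)).
Qed.

Lemma continuous_sum (I : finType) (P : pred I) (F : I -> T -> R) (x : T) :
  (forall i, {for x, continuous (F i)}) ->
  {for x, continuous (fun y => \sum_(i | P i) F i y)}.
Proof.
move=> Fc; apply: cvg_big => [|i _]; first exact: add_continuous.
exact: Fc.
Qed.

Lemma continuous_pospart (F : T -> R) (x : T) :
  {for x, continuous F} -> {for x, continuous (fun y => pospart (F y))}.
Proof.
move=> Fc; apply: (@continuous_max R T F (fun=> 0)) => //.
exact: cst_continuous.
Qed.

Lemma continuous_cum (n : nat) (u : T -> 'I_n -> R) (x : T) a :
  (forall i, {for x, continuous (fun y => u y i)}) ->
  {for x, continuous (fun y => cum (u y) a)}.
Proof. by move=> uc; apply: continuous_sum. Qed.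

Lemma continuous_countermono (n : nat) (u : T -> 'I_n -> R) (x : T) i j :
  (forall i, {for x, continuous (fun y => u y i)}) ->
  {for x, continuous (fun y => countermono (u y) i j)}.
Proof.
move=> uc.
have copula a b : {for x, continuous (fun y => pospart (cum (u y) a + cum (u y) b - 1))}.
  apply: continuous_pospart; apply: continuousB; last exact: cst_continuous.
  by apply: continuousD; apply: continuous_cum.
apply: continuousD; last exact: copula.
apply: continuousB; last exact: copula.
by apply: continuousB; exact: copula.
Qed.

End Continuity.

Lemma continuous_coord (R : realType) (k : nat) (l : 'I_k) (x : 'rV[R]_k) :
  {for x, continuous (fun y : 'rV[R]_k => y 0 l)}.
Proof. exact: coord_continuous. Qed.

(** * The two inverse maps between the core and the sphere *)

Section Homeomorphism.
Variables (R : realType) (m : nat).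
Local Notation n := (2 * m)%N.
Local Notation N := #|{: idx n}|.

Definition coords (x : 'rV[R]_N) (k : idx n) : R := x 0 (enum_rank k).

(** Each x_ij gives half of its mass to i and half to j, as the midpoint (v_i + v_j) / 2
    requires. *)
Definition marginal (x : 'rV[R]_N) (i : 'I_n) : R := \sum_j symm (coords x) i j.

Definition norm2 (y : 'rV[R]_m) : R := Num.sqrt (\sum_l y 0 l ^+ 2).

Definition to_sphere (x : 'rV[R]_N) : 'rV[R]_m :=
  (norm2 (fold (marginal x)))^-1 *: fold (marginal x).

(** Dividing by [norm1] projects z radially onto the boundary of the cross-polytope, and [unfold]
    reads the image as a probability distribution. *)
Definition weights (z : 'rV[R]_m) (i : 'I_n) : R := (norm1 z)^-1 * unfold z i.

Definition of_sphere (z : 'rV[R]_m) : 'rV[R]_N :=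
  \row_j unsymm (countermono (weights z)) (enum_val j).

Lemma norm2_gt0 y : y != 0 -> 0 < norm2 y.
Proof.
move=> y0; rewrite sqrtr_gt0 lt_def sumr_ge0 ?andbT => [|l _]; last exact: sqr_ge0.
apply: contra y0 => /eqP/psumr_eq0P h; apply/eqP/rowP => l.
by rewrite mxE; apply/eqP; rewrite -sqrf_eq0 h // => ? _; apply: sqr_ge0.
Qed.

Lemma sum_sqrZ c (y : 'rV[R]_m) : \sum_l (c *: y) 0 l ^+ 2 = c ^+ 2 * \sum_l y 0 l ^+ 2.
Proof. by rewrite mulr_sumr; apply: eq_bigr => l _; rewrite mxE exprMn. Qed.

Lemma norm2Z c y : 0 <= c -> norm2 (c *: y) = c * norm2 y.
Proof.
by move=> c0; rewrite /norm2 sum_sqrZ sqrtrM ?sqr_ge0 // sqrtr_sqr ger0_norm.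
Qed.

Lemma sphere_neq0 (z : 'rV[R]_m) : unit_sphere z -> z != 0.
Proof.
rewrite /unit_sphere /= => z1; apply/eqP => z0; move: z1; rewrite z0.
rewrite big1 => [/eqP|l _]; first by rewrite eq_sym oner_eq0.
by rewrite mxE expr0n.
Qed.

Lemma continuous_to_sphere x : fold (marginal x) != 0 ->
  {for x, continuous to_sphere}.
Proof.
move=> y0.
have uc i : {for x, continuous (fun x => marginal x i)}.
  apply: continuous_sum => j; apply: continuousM; last exact: cst_continuous.
  exact: continuous_coord.
have yc l : {for x, continuous (fun x => fold (marginal x) 0 l)}.
  have -> : (fun x => fold (marginal x) 0 l) =
            (fun x => marginal x (lo l) - marginal x (rev_ord (lo l))).
    by apply/funext => y; rewrite mxE.
  exact: continuousB.
apply: continuous_row => l.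
have -> : (fun y => to_sphere y 0 l) =
    (fun y => (norm2 (fold (marginal y)))^-1 * fold (marginal y) 0 l).
  by apply/funext => y; rewrite mxE.
apply: continuousM; last exact: yc.
apply: continuousV; first by rewrite gt_eqF // norm2_gt0.
apply: (@continuous_comp _ _ _ (fun y => \sum_l fold (marginal y) 0 l ^+ 2) Num.sqrt).
  by apply: continuous_sum => k; apply: continuousM; exact: yc.
exact: sqrt_continuous.
Qed.

Lemma continuous_of_sphere z : z != 0 -> {for z, continuous of_sphere}.
Proof.
move=> z0.
have vc i : {for z, continuous (fun z : 'rV[R]_m => unfold z i)}.
  apply: continuous_pospart; apply: continuous_sum => l.
  apply: continuousM; last exact: cst_continuous.
  exact: continuous_coord.
apply: continuous_row => k.
have -> : (fun y => of_sphere y 0 k) =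
    (fun y => unsymm (countermono (weights y)) (enum_val k)).
  by apply/funext => y; rewrite mxE.
apply: continuousM; last exact: cst_continuous.
apply: continuous_countermono => i; apply: continuousM; last exact: vc.
apply: continuousV; first by rewrite gt_eqF // norm1_gt0.
exact: continuous_sum.
Qed.

Lemma coords_of_sphere z k : coords (of_sphere z) k = unsymm (countermono (weights z)) k.
Proof. by rewrite /coords mxE enum_rankK. Qed.

Lemma sum_coords x : \sum_k coords x k = \sum_j x 0 j.
Proof.
rewrite (reindex (@enum_rank {: idx n})) //=.
by exists enum_val => ? _; rewrite ?enum_rankK ?enum_valK.
Qed.

Section Simplex.
Variable x : 'rV[R]_N.
Hypotheses (x_ge0 : forall j, 0 <= x 0 j) (x_sum : \sum_j x 0 j = 1).
Hypothesis x_compat : forall p q, coords x p != 0 -> coords x q != 0 -> compat p q.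

Let symm_ge0 i j : 0 <= symm (coords x) i j.
Proof. by apply: mulr_ge0; [exact: x_ge0|case: ifP => // _; rewrite invr_ge0]. Qed.

Lemma marginal_ge0 i : 0 <= marginal x i.
Proof. exact: sumr_ge0. Qed.

Lemma sum_marginal : \sum_i marginal x i = 1.
Proof. by rewrite sum_symm sum_coords. Qed.

Lemma marginal_rev i : marginal x i != 0 -> marginal x (rev_ord i) = 0.
Proof.
have exj k : marginal x k != 0 -> exists j, symm (coords x) k j != 0.
  move=> k0; apply/existsP; apply: contraR k0; rewrite negb_exists => /forallP h.
  by rewrite /marginal big1 // => j _; apply/eqP; rewrite -[_ == _]negbK h.
move=> /exj[j ij]; apply/eqP/negPn/negP => /exj[k rk].
move: ij rk; rewrite /symm !mulf_eq0 !negb_or => /andP[ij _] /andP[rk _].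
have /andP[_ /antipodalP[]] := x_compat ij rk.
exists i, (rev_ord i); rewrite !mem_ends_pairing !eqxx; split=> //.
exact: addn_rev_ord.
Qed.

Lemma unfold_fold_marginal i : unfold (fold (marginal x)) i = marginal x i.
Proof. by apply: foldK; [exact: marginal_ge0|exact: marginal_rev]. Qed.

Lemma norm1_fold_marginal : norm1 (fold (marginal x)) = 1.
Proof.
by rewrite -sum_marginal; apply: eq_bigr => i _; exact: unfold_fold_marginal.
Qed.

Lemma fold_marginal_neq0 : fold (marginal x) != 0.
Proof.
apply/eqP => y0; have := norm1_fold_marginal; rewrite y0 -[0](scale0r 0) norm1Z // mul0r.
by move/eqP; rewrite eq_sym oner_eq0.
Qed.

Lemma to_sphereP : unit_sphere (to_sphere x).
Proof.
have y0 := norm2_gt0 fold_marginal_neq0.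
rewrite /unit_sphere /= sum_sqrZ -[X in _ * X]sqr_sqrtr; last first.
  by apply: sumr_ge0 => ? _; apply: sqr_ge0.
by rewrite -exprMn mulVf ?expr1n // gt_eqF.
Qed.

(** The factor introduced by [norm2] cancels between [unfold] and [norm1], and the folded marginal
    already has [norm1] equal to 1. *)
Lemma weights_to_sphere : weights (to_sphere x) = marginal x.
Proof.
have c0 : 0 < (norm2 (fold (marginal x)))^-1.
  by rewrite invr_gt0 norm2_gt0 // fold_marginal_neq0.
apply/funext => i; rewrite /weights norm1Z ?unfoldZ ?(ltW c0) // norm1_fold_marginal mulr1.
by rewrite mulKf ?unfold_fold_marginal // gt_eqF.
Qed.

Lemma to_sphereK : of_sphere (to_sphere x) = x.
Proof.
apply/rowP => j; rewrite -[j]enum_valK -/(coords _ _) coords_of_sphere weights_to_sphere.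
rewrite -/(coords _ _) -[RHS]symmK /unsymm countermono_unique //.
- exact: symmC.
- exact: sum_marginal.
- exact: compat_antitone.
Qed.

End Simplex.

Section Sphere.
Variable z : 'rV[R]_m.
Hypothesis z_sphere : unit_sphere z.

Let norm1z_gt0 : 0 < norm1 z.
Proof. exact/norm1_gt0/sphere_neq0. Qed.

Lemma weights_ge0 i : 0 <= weights z i.
Proof. by apply: mulr_ge0; rewrite ?invr_ge0 ?unfold_ge0 // ltW. Qed.

Lemma sum_weights : \sum_i weights z i = 1.
Proof. by rewrite -mulr_sumr mulVf // gt_eqF. Qed.

Lemma marginal_of_sphere i : marginal (of_sphere z) i = weights z i.
Proof.
rewrite -[RHS](sum_countermono weights_ge0 sum_weights); apply: eq_bigr => j _.
rewrite -[RHS]unsymmK; last exact: countermonoC.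
by rewrite /symm coords_of_sphere.
Qed.

Lemma of_sphereK : to_sphere (of_sphere z) = z.
Proof.
rewrite /to_sphere; have -> : marginal (of_sphere z) = weights z.
  by apply/funext => i; exact: marginal_of_sphere.
rewrite foldZ unfoldK norm2Z ?invr_ge0 ?(ltW norm1z_gt0) //.
rewrite /norm2 z_sphere sqrtr1 mulr1 scalerA invrK mulfV ?scale1r //.
by rewrite gt_eqF.
Qed.

Lemma of_sphere_ge0 j : 0 <= of_sphere z 0 j.
Proof.
rewrite mxE; apply: mulr_ge0; last by case: ifP.
by apply: countermono_ge0; exact: weights_ge0.
Qed.

Lemma sum_of_sphere : \sum_j of_sphere z 0 j = 1.
Proof.
rewrite -sum_coords -sum_symm -sum_weights.
by apply: eq_bigr => i _; exact: marginal_of_sphere.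
Qed.

Lemma of_sphere_compat p q : coords (of_sphere z) p != 0 ->
  coords (of_sphere z) q != 0 -> compat p q.
Proof.
rewrite !coords_of_sphere /unsymm !mulf_eq0 !negb_or => /andP[hp _] /andP[hq _].
have w0 := weights_ge0.
apply/andP; split.
  have hpq := @countermono_antitone _ _ _ w0 _ _ _ _ _ _ hp hq.
  have hqp := @countermono_antitone _ _ _ w0 _ _ _ _ _ _ hq hp.
  (* Different left ends force the right ends into the opposite order; equal left ends are always
     nested. *)
  rewrite /nested; case: (ltngtP (val p).1 (val q).1) => /= e1.
  - by rewrite leqNgt orbF; apply/negP => /(hpq e1).
  - by rewrite leqNgt; apply/negP => /(hqp e1).
  - exact: leq_total.
have end_neq0 r i : countermono (weights z) (val r).1 (val r).2 != 0 ->
    i \in ends r -> unfold z i != 0.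
  move=> /(countermono_neq0 w0)[_ _ r1 r2]; rewrite !inE => /orP[/eqP ->|/eqP ->].
    by move: r1; rewrite mulf_eq0 negb_or => /andP[].
  by move: r2; rewrite mulf_eq0 negb_or => /andP[].
apply/antipodalP => -[i [j [/(end_neq0 _ _ hp) ip /(end_neq0 _ _ hq) jq ij]]].
move: jq; rewrite (_ : j = rev_ord i) ?unfold_rev ?eqxx //.
by apply: val_inj => /=; have := ltn_ord i; lia.
Qed.

End Sphere.

End Homeomorphism.

Theorem theorem5p5 (R : realType) (m : nat) (hm : (1 <= m)%N)
  (rank : idx (2 * m) -> nat) (rank_inj : injective rank)
  (h_anti_order : forall a b : idx (2 * m), antidiag a -> antidiag b ->
      ((val a).1 < (val b).1)%N -> (rank a < rank b)%N)
  (h_anti_small : forall a b : idx (2 * m), antidiag a -> ~~ antidiag b ->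
      (rank a < rank b)%N)
  (h_gap : forall a b : idx (2 * m), ~~ antidiag a -> ~~ antidiag b ->
      (gap a < gap b)%N -> (rank b < rank a)%N) :
  homeomorphic
    (realization (revlex_core (@P2pt R (2 * m)) rank))
    (@unit_sphere R m).
Proof.
have n_even : ~~ odd (2 * m) by rewrite oddM.
have n_gt0 : (0 < 2 * m)%N by rewrite muln_gt0.
have coreE := revlex_coreE R n_even h_anti_small h_gap _ n_gt0.
(* The core is defined by a condition on pairs, so membership in its realization is a condition on
   pairs of nonzero coordinates. *)
have realP (x : 'rV[R]_#|{: idx (2 * m)}|) :
    realization (revlex_core (@P2pt R (2 * m)) rank) x <->
    [/\ forall j, 0 <= x 0 j, \sum_j x 0 j = 1 &
        forall p q, coords x p != 0 -> coords x q != 0 -> compat p q].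
  split=> [[x0 [x1 /coreE xC]]|[x0 x1 xC]].
    by split=> // p q p0 q0; apply: xC; rewrite inE.
  by split=> //; split=> //; apply/coreE => p q; rewrite !inE; apply: xC.
exists (@to_sphere R m), (@of_sphere R m); split; [|split; [|split; [|split; [|split]]]].
(* Both maps are continuous in the ambient space at each point of their domain, because the vector
   being normalized is nonzero there. *)
- apply: continuous_in_subspaceT => x /set_mem /realP[x0 x1 xC].
  exact/continuous_to_sphere/fold_marginal_neq0.
- apply: continuous_in_subspaceT => z /set_mem /sphere_neq0.
  exact: continuous_of_sphere.
- by move=> x /realP[]; exact: to_sphereP.
- move=> z z1; apply/realP; split.
  + exact: of_sphere_ge0.
  + exact: sum_of_sphere.
  + exact: of_sphere_compat.
- by move=> x /realP[]; exact: to_sphereK.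
- exact: of_sphereK.
Qed.
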